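(* Let $f:\mathbb{R}^d\to\mathbb{R}$ be twice differentiable and let $H>0$ be such that for all $x,y\in\mathbb{R}^d$ $$f(y)\le f(x)+\langle\nabla f(x),y-x\rangle+\tfrac12\langle\nabla^2 f(x)(y-x),y-x\rangle+\tfrac H3\|y-x\|^3,\qquad \|\nabla f(y)-\nabla f(x)-\nabla^2 f(x)(y-x)\|\le H\|y-x\|^2 .$$ Let $\alpha\in(0,1)$ and $x^k\in\mathbb{R}^d$ with $\nabla f(x^k)\ne0$. For $0<H_k\le H$ put $$M_k=\max\Big\{H_k,\ \frac{9\,\langle\nabla f(x^k),\nabla^2 f(x^k)\nabla f(x^k)\rangle^2}{16\alpha^2\|\nabla f(x^k)\|^5}\Big\},\qquad x^{k+1}=x^k-\frac{\nabla f(x^k)}{\sqrt{M_k\|\nabla f(x^k)\|}} .$$ There exists $H_k\in(0,H]$ such that $$f(x^{k+1})\le f(x^k)+\langle\nabla f(x^k),x^{k+1}-x^k\rangle+\tfrac12\langle x^{k+1}-x^k,\nabla^2 f(x^k)(x^{k+1}-x^k)\rangle+\tfrac{H_k}{3}\|x^{k+1}-x^k\|^3, \qquad (\ast)$$ and for every $H_k\in(0,H]$ satisfying $(\ast)$ one has $$f(x^{k+1})\le f(x^k)-\frac{2(1-\alpha)}{3\sqrt{M_k}}\|\nabla f(x^k)\|^{3/2}.$$ In particular: (I) if $M_k=H_k$, then $f(x^{k+1})\le f(x^k)-\frac{2(1-\alpha)}{3\sqrt{H_k}}\|\nabla f(x^k)\|^{3/2}$; (II) if $M_k=\frac{9\langle\nabla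 f(x^k),\nabla^2 f(x^k)\nabla f(x^k)\rangle^2}{16\alpha^2\|\nabla f(x^k)\|^5}$, then $f(x^{k+1})\le f(x^k)-\frac{8(1-\alpha)\alpha}{9L_k}\|\nabla f(x^k)\|^2$, where $L_k=\frac{\langle\nabla f(x^k),\nabla^2 f(x^k)\nabla f(x^k)\rangle}{\|\nabla f(x^k)\|^2}$.
   Context: $\|\cdot\|$ is the Euclidean norm on $\mathbb{R}^d$. *)

(* Defs.v *)
From HB Require Import structures.
From mathcomp Require Import all_boot all_order all_algebra.
From mathcomp Require Import all_classical all_reals all_analysis.

Set Implicit Arguments.
Unset Strict Implicit.
Unset Printing Implicit Defensive.

Import Order.TTheory GRing.Theory Num.Theory.
Import numFieldNormedType.Exports.

Local Open Scope ring_scope.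

Section Defs.
Context {R : realType} {d : nat}.
Implicit Types (f : 'rV[R]_d -> R) (u v x : 'rV[R]_d).

Definition dot u v : R := \sum_(i < d) u 0 i * v 0 i.

(* The norm `|u| that MathComp-Analysis puts on 'rV[R]_d is the sup norm. It
   gives the same topology and the same derivatives as the Euclidean norm, but
   not the same inequalities. *)
Definition enorm u : R := Num.sqrt (dot u u).

Definition grad f x : 'rV[R]_d := \row_(i < d) 'D_(delta_mx 0 i) f x.

(* As vectors are rows, the value of the Hessian operator at v, that is the
   differential of grad f at x applied to v, is v *m hess f x. *)
Definition hess f x : 'M[R]_d := 'J (grad f) x.

Definition twice_differentiable f : Prop :=
  (forall x, differentiable f x) /\ (forall x, differentiable (grad f) x).

Definition curv f x : R := dot (grad f x) (grad f x *m hess f x).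

Definition curvM f (alpha : R) x : R :=
  9 * curv f x ^+ 2 / (16 * alpha ^+ 2 * enorm (grad f x) ^+ 5).

Definition regM f (alpha : R) x (Hk : R) : R := Num.max Hk (curvM f alpha x).

Definition next_iterate f (alpha : R) x (Hk : R) : 'rV[R]_d :=
  x - (Num.sqrt (regM f alpha x Hk * enorm (grad f x)))^-1 *: grad f x.

Definition curvL f x : R := curv f x / enorm (grad f x) ^+ 2.

(* The upper bound on f y given by the cubic model of f at x with parameter c. *)
Definition cubic_bound f (c : R) x (y : 'rV[R]_d) : Prop :=
  f y <= f x + dot (grad f x) (y - x)
         + 2^-1 * dot ((y - x) *m hess f x) (y - x)
         + c / 3 * enorm (y - x) ^+ 3.

End Defs.

(* Main.v *)
Require Import Defs.
From HB Require Import structures.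
From mathcomp Require Import all_boot all_order all_algebra.
From mathcomp Require Import all_classical all_reals all_analysis.
From mathcomp Require Import ring.
Set Implicit Arguments.
Unset Strict Implicit.
Unset Printing Implicit Defensive.
Import Order.TTheory GRing.Theory Num.Theory.
Import numFieldNormedType.Exports.
Local Open Scope ring_scope.

(** Along the step [- t *: grad f x] the cubic model is a polynomial in [t],
with [g] the Euclidean norm of the gradient and [c = curv f x]:
[f x - t * g ^+ 2 + t ^+ 2 * c / 2 + Hk / 3 * (t * g) ^+ 3].  The step length is
chosen so that [M * g * t ^+ 2 = 1]; as [Hk <= M], the cubic term then takes back
at most a third of the linear decrease [t * g ^+ 2], and as
[M >= 9 c ^+ 2 / (16 alpha ^+ 2 g ^+ 5)], the curvature term takes back at most
[2 alpha / 3] of it.  What is left is [2 (1 - alpha) / 3 * (t * g ^+ 2)], and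
[t * g ^+ 2] is [g `^ (3 / 2)] divided by the square root of [M]
([cubic_model_decrease]).

When the second term attains the maximum defining [M], the square root of [M] is
[3 |c| / (4 alpha g `^ (5 / 2))], which turns the decrease into
[8 (1 - alpha) alpha / (9 |L|) * g ^+ 2] with [L = curvL f x]; since
[L^-1 <= |L|^-1], this is at least as strong as the claim
([curvature_regime_decrease]).

A suitable [Hk] exists because [H] itself is one: the cubic bound with constant
[H] holds between any two points. *)

(** * Euclidean inner product and norm *)

Section EuclideanNorm.
Context {R : realType} {d : nat}.
Implicit Types (u v : 'rV[R]_d).

Lemma dotC u v : dot u v = dot v u.
Proof. by apply: eq_bigr => i _; rewrite mulrC. Qed.

Lemma dotZl (a : R) u v : dot (a *: u) v = a * dot u v.
Proof. by rewrite /dot mulr_sumr; apply: eq_bigr => i _; rewrite mxE mulrA. Qed.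

Lemma dotZr (a : R) u v : dot u (a *: v) = a * dot u v.
Proof. by rewrite dotC dotZl dotC. Qed.

Lemma dot_ge0 u : 0 <= dot u u.
Proof. by apply: sumr_ge0 => i _; rewrite -expr2 sqr_ge0. Qed.

Lemma sqr_enorm u : enorm u ^+ 2 = dot u u.
Proof. by rewrite sqr_sqrtr // dot_ge0. Qed.

Lemma enormZ (a : R) u : enorm (a *: u) = `|a| * enorm u.
Proof.
by rewrite /enorm dotZl dotZr mulrA -expr2 sqrtrM ?sqr_ge0 // sqrtr_sqr.
Qed.

Lemma enorm_gt0 u : u != 0 -> 0 < enorm u.
Proof.
move=> u_neq0; rewrite sqrtr_gt0 lt_neqAle dot_ge0 andbT eq_sym.
apply: contra u_neq0 => /eqP dot_eq0; apply/eqP/rowP => i; rewrite mxE.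
have sq_ge0 (j : 'I_d) : true -> 0 <= u 0 j * u 0 j by rewrite -expr2 sqr_ge0.
have /(_ i isT)/eqP := psumr_eq0P sq_ge0 dot_eq0.
by rewrite mulf_eq0 orbb => /eqP.
Qed.

End EuclideanNorm.

(** * Scalar estimates *)

Section ScalarEstimates.
Context {R : realType}.
Implicit Types (alpha c k q r g : R).

Lemma powR_three_halves g : 0 <= g -> g `^ (3 / 2) = Num.sqrt g ^+ 3.
Proof.
by move=> g_ge0; rewrite mulrC powRrM powR12_sqrt // powR_mulrn // sqrtr_ge0.
Qed.

(** Here [q] and [r] are the square roots of the regularization parameter and of
the gradient norm, which makes every term rational: the step length is
[(q * r)^-1] and the hypothesis on [c] is the square of
[|c| <= 4 / 3 * alpha * q * r ^+ 5]. *)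
Lemma cubic_model_decrease alpha c k q r :
  0 < alpha -> 0 < q -> 0 < r -> k <= q ^+ 2 ->
  9 * c ^+ 2 <= 16 * alpha ^+ 2 * (r ^+ 2) ^+ 5 * q ^+ 2 ->
  - ((q * r)^-1 * (r ^+ 2) ^+ 2) + 2^-1 * ((q * r)^-1 ^+ 2 * c)
    + k / 3 * ((q * r)^-1 * r ^+ 2) ^+ 3
  <= - (2 * (1 - alpha) / (3 * q) * r ^+ 3).
Proof.
move=> alpha_gt0 q_gt0 r_gt0 k_le c_sq_le.
have c_le : 3 * c <= 4 * alpha * q * r ^+ 5.
  have bound_ge0 : 0 <= 4 * alpha * q * r ^+ 5.
    by rewrite !mulr_ge0 ?exprn_ge0 // ltW.
  apply: le_trans (ler_norm _) _.
  rewrite -(ler_pXn2r (n := 2)) ?nnegrE // real_normK ?num_real //.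
  have -> : (3 * c) ^+ 2 = 9 * c ^+ 2 by ring.
  by have -> : (4 * alpha * q * r ^+ 5) ^+ 2
    = 16 * alpha ^+ 2 * (r ^+ 2) ^+ 5 * q ^+ 2 by ring.
have [q_neq0 r_neq0] : q != 0 /\ r != 0 by rewrite !gt_eqF.
rewrite -subr_ge0.
have -> : - (2 * (1 - alpha) / (3 * q) * r ^+ 3)
    - (- ((q * r)^-1 * (r ^+ 2) ^+ 2) + 2^-1 * ((q * r)^-1 ^+ 2 * c)
       + k / 3 * ((q * r)^-1 * r ^+ 2) ^+ 3)
  = (4 * alpha * q * r ^+ 5 - 3 * c) / (6 * (q * r) ^+ 2)
    + (q ^+ 2 - k) * r ^+ 3 / (3 * q ^+ 3).
  by field; rewrite q_neq0 r_neq0.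
by rewrite addr_ge0 // divr_ge0 ?mulr_ge0 ?exprn_ge0 ?mulr_ge0 ?subr_ge0 // ltW.
Qed.

(** The left side is the claimed decrease [8 (1 - alpha) alpha / (9 L) * g ^+ 2]
with [L = c / g ^+ 2]; for [c < 0] it is negative, and the two sides agree
when [c > 0]. *)
Lemma curvature_regime_decrease alpha c q r :
  0 < alpha -> alpha < 1 -> 0 < q -> 0 < r ->
  q ^+ 2 = 9 * c ^+ 2 / (16 * alpha ^+ 2 * (r ^+ 2) ^+ 5) ->
  8 * (1 - alpha) * alpha / (9 * (c / (r ^+ 2) ^+ 2)) * (r ^+ 2) ^+ 2
  <= 2 * (1 - alpha) / (3 * q) * r ^+ 3.
Proof.
move=> alpha_gt0 alpha_lt1 q_gt0 r_gt0 q_sq.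
have [alpha_neq0 r_neq0] : alpha != 0 /\ r != 0 by rewrite !gt_eqF.
have c_neq0 : c != 0.
  apply/eqP => c_eq0; move: q_sq; rewrite c_eq0 expr0n mulr0 mul0r => /eqP.
  by rewrite sqrf_eq0 gt_eqF.
have q_eq : q = 3 * `|c| / (4 * alpha * r ^+ 5).
  apply/eqP; rewrite -(eqrXn2 (n := 2)) //; last first.
  - by rewrite divr_ge0 ?mulr_ge0 ?exprn_ge0 // ltW.
  - exact: ltW.
  rewrite q_sq !exprMn exprVn real_normK ?num_real //; apply/eqP; field.
  by rewrite alpha_neq0 r_neq0.
have -> : 2 * (1 - alpha) / (3 * q) * r ^+ 3
    = 8 * (1 - alpha) * alpha * r ^+ 8 / 9 * `|c|^-1.
  by rewrite q_eq; field; rewrite normr_eq0 c_neq0 alpha_neq0 r_neq0.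
have -> : 8 * (1 - alpha) * alpha / (9 * (c / (r ^+ 2) ^+ 2)) * (r ^+ 2) ^+ 2
    = 8 * (1 - alpha) * alpha * r ^+ 8 / 9 * c^-1.
  by field; rewrite c_neq0 r_neq0.
apply: ler_wpM2l; last by rewrite -normfV ler_norm.
by rewrite divr_ge0 ?mulr_ge0 ?exprn_ge0 ?subr_ge0 // ltW.
Qed.

End ScalarEstimates.

(** * Decrease of the objective *)

Lemma cubic_bound_grad_step (R : realType) (d : nat) (f : 'rV[R]_d -> R)
    (c t : R) (x : 'rV[R]_d) :
  0 <= t -> cubic_bound f c x (x - t *: grad f x) ->
  f (x - t *: grad f x)
  <= f x + (- (t * enorm (grad f x) ^+ 2) + 2^-1 * (t ^+ 2 * curv f x)
            + c / 3 * (t * enorm (grad f x)) ^+ 3).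
Proof.
move=> t_ge0; rewrite /cubic_bound.
have -> : x - t *: grad f x - x = - t *: grad f x.
  by rewrite addrC addKr scaleNr.
rewrite enormZ normrN (ger0_norm t_ge0) -scalemxAl dotZl !dotZr -sqr_enorm.
rewrite (dotC (grad f x *m _)) -/(curv f x).
by rewrite mulNr (mulrA (- t) (- t)) mulrNN -expr2 -!addrA.
Qed.

Theorem mainTheorem1 (R : realType) (d : nat) (f : 'rV[R]_d -> R) (H : R)
  (f_diff2 : twice_differentiable f)
  (H_gt0 : 0 < H)
  (f_cubic : forall x y : 'rV[R]_d, cubic_bound f H x y)
  (grad_quad : forall x y : 'rV[R]_d,
     enorm (grad f y - grad f x - (y - x) *m hess f x) <= H * enorm (y - x) ^+ 2)
  (alpha : R) (alpha_gt0 : 0 < alpha) (alpha_lt1 : alpha < 1)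
  (x : 'rV[R]_d) (grad_neq0 : grad f x != 0) :
  (exists Hk : R, [/\ 0 < Hk, Hk <= H & cubic_bound f Hk x (next_iterate f alpha x Hk)])
  /\
  (forall Hk : R, 0 < Hk -> Hk <= H -> cubic_bound f Hk x (next_iterate f alpha x Hk) ->
     [/\ f (next_iterate f alpha x Hk) <=
           f x - 2 * (1 - alpha) / (3 * Num.sqrt (regM f alpha x Hk))
                 * enorm (grad f x) `^ (3 / 2),
         regM f alpha x Hk = Hk ->
           f (next_iterate f alpha x Hk) <=
             f x - 2 * (1 - alpha) / (3 * Num.sqrt Hk)
                   * enorm (grad f x) `^ (3 / 2)
       & regM f alpha x Hk = curvM f alpha x ->
           f (next_iterate f alpha x Hk) <=
             f x - 8 * (1 - alpha) * alpha / (9 * curvL f x)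
                   * enorm (grad f x) ^+ 2]).
Proof.
set g := enorm (grad f x); set r := Num.sqrt g.
have g_gt0 : 0 < g by exact: enorm_gt0.
have r_gt0 : 0 < r by rewrite sqrtr_gt0.
have r_sq : r ^+ 2 = g by rewrite sqr_sqrtr // ltW.
split; first by exists H; split=> //; exact: f_cubic.
move=> Hk Hk_gt0 Hk_le_H cubic.
set M := regM f alpha x Hk; set q := Num.sqrt M.
have Hk_le_M : Hk <= M by rewrite /M /regM le_max lexx.
have M_gt0 : 0 < M := lt_le_trans Hk_gt0 Hk_le_M.
have q_gt0 : 0 < q by rewrite sqrtr_gt0.
have q_sq : q ^+ 2 = M by rewrite sqr_sqrtr // ltW.
have curv_le : 9 * curv f x ^+ 2 <= 16 * alpha ^+ 2 * (r ^+ 2) ^+ 5 * q ^+ 2.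
  rewrite r_sq q_sq [leRHS]mulrC -ler_pdivrMr; last first.
    by rewrite !mulr_gt0 ?exprn_gt0.
  by rewrite -/(curvM f alpha x) /M /regM le_max lexx orbT.
have decrease : f (next_iterate f alpha x Hk)
    <= f x - 2 * (1 - alpha) / (3 * q) * g `^ (3 / 2).
  have step_eq : next_iterate f alpha x Hk = x - (q * r)^-1 *: grad f x.
    by rewrite /next_iterate -/M -/g sqrtrM // ltW.
  rewrite step_eq in cubic *.
  have t_ge0 : 0 <= (q * r)^-1 by rewrite invr_ge0 mulr_ge0 // ltW.
  apply: le_trans (cubic_bound_grad_step t_ge0 cubic) _.
  rewrite lerD2l powR_three_halves; last exact: ltW.
  rewrite -/g -/r -r_sq; apply: cubic_model_decrease => //.
  by rewrite q_sq.
split=> //; first by move=> M_eq; rewrite -[X in Num.sqrt X]M_eq.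
move=> M_eq; apply: le_trans decrease _; rewrite lerD2l lerN2.
rewrite powR_three_halves; last exact: ltW.
rewrite /curvL -/g -/r -r_sq; apply: curvature_regime_decrease => //.
by rewrite q_sq M_eq /curvM -/g -r_sq.
Qed.
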